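(* Let $S,T\in\mathbb{R}^{n\times n}$ be such that the pencil $S+\lambda T$ is singular, that is, $\det(S+\lambda T)\equiv 0$ as a polynomial in $\lambda$. Then there exist $Q,Z\in SO(n)$ such that $QSZ$ and $QTZ$ are both (real and) upper triangular.
   Context: $SO(n)$ denotes the special orthogonal group, i.e. the set of real orthogonal $n\times n$ matrices with determinant $1$. *)

(* Defs.v *)
From mathcomp Require Import all_boot all_order all_algebra.
From mathcomp Require Import reals.
Set Implicit Arguments.
Unset Strict Implicit.
Unset Printing Implicit Defensive.
Import GRing.Theory Num.Theory.
Local Open Scope ring_scope.

(* The pencil S + λT as a matrix of polynomials in λ = 'X. *)
Definition pencil (R : realType) (n : nat) (S T : 'M[R]_n) : 'M[{poly R}]_n :=
  map_mx polyC S + 'X *: map_mx polyC T.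

Definition singular_pencil (R : realType) (n : nat) (S T : 'M[R]_n) : Prop :=
  \det (pencil S T) = 0.

Definition in_SO (R : realType) (n : nat) (Q : 'M[R]_n) : Prop :=
  Q^T *m Q = 1%:M /\ \det Q = 1.

(* [is_trig_mx] is lower triangularity: entries with i < j vanish. *)
Definition upper_triangular (R : realType) (n : nat) (A : 'M[R]_n) : bool :=
  is_trig_mx A^T.

(* Main.v *)
Require Import Defs.
From mathcomp Require Import all_boot all_order all_algebra perm.
From mathcomp Require Import reals.
Set Implicit Arguments.
Unset Strict Implicit.
Unset Printing Implicit Defensive.
Import Order.TTheory GRing.Theory Num.Theory.
Local Open Scope ring_scope.

(** Transposing the pencil turns the goal into lower triangularity, which suits
    the row-vector conventions: a row space [V] is sent by the pencil into
    [V *m S + V *m T].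

    The point is that singularity yields a [V] of some dimension [k + 1] whose
    image has dimension at most [k] ([singular_pencil_rank_drop]): a polynomial
    row vector [x] killed by [S + 'X T] satisfies [x_0 S = 0] and
    [x_(i+1) S = - x_i T], so the span [V] of its coefficients has
    [V S <= V T], and the last nonzero coefficient is killed by [T], so [T]
    lowers the rank of [V].  In bases adapted to [V] and to its image, both
    matrices get a zero upper right block, which leaves a pencil with [k + 1]
    rows and [k] columns and one with [l] rows and [l + 1] columns.

    A pencil with one row more than it has columns can always be brought to
    lower triangular form ([tall_pair_trig]): [S] has a nonzero left null vector
    [v], and [v T] alone spans the image of [v], so a row can be split off
    together with a column.  No eigenvalue is involved, which is why the field
    does not have to be algebraically closed.  Transposing and reversing the
    order of the bases puts the other block in lower Hessenberg form
    ([wide_pair_hess]).  That block starts one column left of the diagonal of the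
    whole matrix, so its Hessenberg form is what makes the whole matrix lower
    triangular ([deflating_trig]).

    The bases found so far are arbitrary.  The Gram-Schmidt process
    ([orthonormalize_lower]) makes each of them orthonormal through a triangular
    change of basis, which preserves triangularity of the pencil, and a final
    change of sign of one basis vector makes the determinants equal to 1. *)

(** * Triangular, reversed and block matrices *)

Lemma mulmx_is_trig (F : fieldType) (m n p : nat) (A : 'M[F]_(m, n))
    (B : 'M[F]_(n, p)) :
  is_trig_mx A -> is_trig_mx B -> is_trig_mx (A *m B).
Proof.
move=> /is_trig_mxP tA /is_trig_mxP tB; apply/is_trig_mxP => i j lt_ij.
rewrite mxE big1 // => k _; case: (ltnP i k) => [lt_ik|le_ki].
  by rewrite tA ?mul0r.
by rewrite tB ?mulr0 //; apply: leq_ltn_trans lt_ij.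
Qed.

Definition rev_mx (F : fieldType) (n : nat) : 'M[F]_n :=
  perm_mx (perm (@rev_ord_inj n)).

Lemma rev_mxE (F : fieldType) (m n : nat) (A : 'M[F]_(m, n)) (i : 'I_m) (j : 'I_n) :
  (rev_mx F m *m A *m (rev_mx F n)^T) i j = A (rev_ord i) (rev_ord j).
Proof. by rewrite tr_perm_mx -col_permE -row_permE !mxE !permE. Qed.

Lemma block_diag_unitmx (F : fieldType) (m n : nat) (A : 'M[F]_m) (B : 'M[F]_n) :
  A \in unitmx -> B \in unitmx -> block_mx A 0 0 B \in unitmx.
Proof. by rewrite !unitmxE det_ublock unitrM => -> ->. Qed.

Lemma mul_block_diag (F : fieldType) (m1 m2 n1 n2 : nat) (P1 : 'M[F]_m1)
    (P2 : 'M[F]_m2) (A : 'M[F]_(m1 + m2, n1 + n2)) (Z1 : 'M[F]_n1)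
    (Z2 : 'M[F]_n2) :
  ursubmx A = 0 ->
  block_mx P1 0 0 P2 *m A *m block_mx Z1 0 0 Z2 =
  block_mx (P1 *m ulsubmx A *m Z1) 0
           (P2 *m dlsubmx A *m Z1) (P2 *m drsubmx A *m Z2).
Proof.
move=> A0; rewrite -{1}(submxK A) A0 !mulmx_block.
by rewrite !(mulmx0, mul0mx, add0r, addr0).
Qed.

(** * Bases adapted to a subspace and its image *)

(** The extended row basis of [V] starts with a basis of the row space of [V]. *)
Lemma usubmx_row_ebase (F : fieldType) (a b n : nat) (V : 'M[F]_(n, a + b)) :
  (a <= \rank V)%N -> (usubmx (row_ebase V) <= V)%MS.
Proof.
move=> le_aV.
have -> : usubmx (row_ebase V) =
    (pid_mx a : 'M_(a, n)) *m (pid_mx (\rank V) *m row_ebase V).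
  rewrite mulmxA mul_pid_mx.
  have -> : minn n (minn a (\rank V)) = a.
    by rewrite (minn_idPl le_aV) (minn_idPr (leq_trans le_aV (rank_leq_row V))).
  by rewrite -[in RHS](vsubmxK (row_ebase V)) pid_mx_row
             mul_row_col mul1mx mul0mx addr0.
apply: mulmx_sub.
have -> : pid_mx (\rank V) *m row_ebase V = invmx (col_ebase V) *m V.
  by rewrite -[X in _ = _ *m X](mulmx_ebase V) -mulmxA mulKmx // col_ebase_unit.
exact: submxMl.
Qed.

(** In the coordinates given by the extended row basis of [X], the row space of
    [X] is spanned by the first [\rank X] basis vectors. *)
Lemma rsubmx_mul_row_ebase (F : fieldType) (m p c d : nat)
    (A : 'M[F]_(m, c + d)) (X : 'M[F]_(p, c + d)) :
  (A <= X)%MS -> (\rank X <= c)%N -> rsubmx (A *m invmx (row_ebase X)) = 0.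
Proof.
move=> /submxP[D ->] le_Xc.
rewrite -{1}(mulmx_ebase X) !mulmxA mulmxK ?row_ebase_unit //.
apply/matrixP=> i j; rewrite !mxE big1 // => k _; rewrite !mxE /=.
case: eqP => /= [->|]; last by rewrite mulr0.
by rewrite ltnNge (leq_trans le_Xc) ?leq_addr // mulr0.
Qed.

Lemma deflating_block (F : fieldType) (a b c d n : nat)
    (S T : 'M[F]_(a + b, c + d)) (V : 'M[F]_(n, a + b)) :
  (a <= \rank V)%N -> (\rank (V *m S + V *m T)%MS <= c)%N ->
  exists P Z, [/\ P \in unitmx, Z \in unitmx,
    ursubmx (P *m S *m Z) = 0 & ursubmx (P *m T *m Z) = 0].
Proof.
move=> le_aV le_Xc; set X := (V *m S + V *m T)%MS in le_Xc.
exists (row_ebase V), (invmx (row_ebase X)).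
rewrite unitmx_inv !row_ebase_unit; split=> //.
all: rewrite /ursubmx -!mul_usub_mx; apply: rsubmx_mul_row_ebase le_Xc.
all: apply: submx_trans (submxMr _ (usubmx_row_ebase le_aV)) _.
  exact: addsmxSl.
exact: addsmxSr.
Qed.

(** * Triangular forms of pencils that are one row or one column off square *)

(** For a nonzero [v] with [v S = 0], the image of the line of [v] under the
    pencil is at most the line of [v T], so [v] splits off one row and one column
    and leaves a pencil of the same shape. *)
Lemma tall_pair_trig (F : fieldType) (m : nat) (S T : 'M[F]_(m.+1, m)) :
  exists P Z, [/\ P \in unitmx, Z \in unitmx,
    is_trig_mx (P *m S *m Z) & is_trig_mx (P *m T *m Z)].
Proof.
elim: m S T => [|m IHm] S T.
  exists 1%:M, 1%:M; rewrite !unitmx1.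
  by split=> //; apply/is_trig_mxP => i [].
(* The sizes are restated as sums for the block decomposition. *)
suff step (S' T' : 'M[F]_(1 + m.+1, 1 + m)) :
    exists (P : 'M_(1 + m.+1)) (Z : 'M_(1 + m)), [/\ P \in unitmx, Z \in unitmx,
      is_trig_mx (P *m S' *m Z) & is_trig_mx (P *m T' *m Z)] by exact: step.
have kS : (0 < \rank (kermx S'))%N.
  by rewrite mxrank_ker subn_gt0 ltnS rank_leq_col.
pose v := nz_row (kermx S').
have v0 : v != 0 by rewrite nz_row_eq0 -mxrank_eq0 -lt0n.
have vS : v *m S' = 0 by apply/sub_kermxP/nz_row_sub.
have rv : (1 <= \rank v)%N by rewrite lt0n mxrank_eq0.
have rX : (\rank (v *m S' + v *m T')%MS <= 1)%N.
  by rewrite vS adds0mx; apply: rank_leq_row.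
have [P0 [Z0 [uP0 uZ0 S0 T0]]] := deflating_block rv rX.
have [P1 [Z1 [uP1 uZ1 tS tT]]] :=
  IHm (drsubmx (P0 *m S' *m Z0)) (drsubmx (P0 *m T' *m Z0)).
exists (block_mx 1%:M 0 0 P1 *m P0), (Z0 *m block_mx 1%:M 0 0 Z1).
rewrite !unitmx_mul uP0 uZ0 !block_diag_unitmx ?unitmx1 //.
split=> //; rewrite !mulmxA -2!(mulmxA (block_mx _ _ _ _)) mul_block_diag //;
  by rewrite is_trig_block_mx // eqxx mx11_is_trig.
Qed.

(** This condition on rectangular matrices says that [A] becomes lower
    triangular once it is moved one column to the left, or one row down. *)
Definition lower_hessenberg (F : fieldType) (m n : nat) (A : 'M[F]_(m, n)) :=
  forall (i : 'I_m) (j : 'I_n), (i.+1 < j)%N -> A i j = 0.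

(** Transposition maps this shape to that of [tall_pair_trig] but turns lower
    triangular matrices into upper triangular ones; reversing the orders of both
    bases makes them lower again.  As there is one column more than there are
    rows, the reversed diagonal ends in the last column, hence starts in the
    second one. *)
Lemma wide_pair_hess (F : fieldType) (m : nat) (S T : 'M[F]_(m, m.+1)) :
  exists P Z, [/\ P \in unitmx, Z \in unitmx,
    lower_hessenberg (P *m S *m Z) & lower_hessenberg (P *m T *m Z)].
Proof.
have [P [Z [uP uZ /is_trig_mxP tS /is_trig_mxP tT]]] := tall_pair_trig S^T T^T.
exists (rev_mx F m *m Z^T), (P^T *m (rev_mx F m.+1)^T).
rewrite !unitmx_mul !unitmx_tr uP uZ !unitmx_perm.
have flip (A : 'M[F]_(m, m.+1)) i j :
    (rev_mx F m *m Z^T *m A *m (P^T *m (rev_mx F m.+1)^T)) i j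
    = (P *m A^T *m Z) (rev_ord j) (rev_ord i).
  rewrite !mulmxA -2!(mulmxA (rev_mx F m)) rev_mxE.
  by rewrite -[A in LHS]trmxK -!trmx_mul mxE mulmxA.
split=> // i j lt_ij; rewrite flip ?tS ?tT //=.
all: by rewrite subSS ltn_sub2l // (leq_trans lt_ij) // -ltnS ltn_ord.
Qed.

(** * Deflation of a singular pencil *)

(** [V] is the span of the coefficients [c i] of a polynomial null vector.  The
    relations [c 0 *m S = 0] and [c i.+1 *m S = - (c i *m T)] put the image of [V]
    under [S] inside its image under [T], so that only the rank of [V *m T]
    matters. *)
Lemma singular_pencil_rank_drop (F : fieldType) (n : nat) (S T : 'M[F]_n) :
  \det (map_mx polyC S + 'X *: map_mx polyC T) = 0 ->
  exists V : 'M[F]_n, (\rank (V *m S + V *m T)%MS < \rank V)%N.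
Proof.
move=> /eqP/det0P[x x0 xM].
pose c i : 'rV[F]_n := \row_j (x 0 j)`_i.
have cS0 : c 0%N *m S = 0.
  apply/rowP=> j; have /rowP/(_ j)/(congr1 (fun p : {poly F} => p`_0)) := xM.
  rewrite !mxE coef_sum coef0 => xMj; rewrite -[RHS]xMj; apply: eq_bigr => k _.
  by rewrite !mxE mulrDr coefD mulrCA coefXM addr0 coefMC.
have cST i : c i.+1 *m S = - (c i *m T).
  apply/eqP; rewrite -subr_eq0 opprK; apply/eqP/rowP=> j.
  have /rowP/(_ j)/(congr1 (fun p : {poly F} => p`_i.+1)) := xM.
  rewrite !mxE coef_sum coef0 -big_split => xMj; rewrite -[RHS]xMj.
  apply: eq_bigr => k _.
  by rewrite !mxE mulrDr coefD mulrCA coefXM !coefMC.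
pose N := \max_(j < n) size (x 0%R j).
have cN i : (N <= i)%N -> c i = 0.
  move=> leNi; apply/rowP=> j; rewrite !mxE nth_default //.
  exact: leq_trans (leq_bigmax j) leNi.
(* [c d] is the coefficient of highest degree; it witnesses the rank drop, since
   it belongs to [V] and is killed by [T]. *)
have [d cd0 cd1] : exists2 d, c d != 0 & c d.+1 = 0.
  have ex_c : exists i, c i != 0.
    have /rV0Pn[j xj0] := x0; exists (size (x 0 j)).-1.
    by apply/rV0Pn; exists j; rewrite mxE -lead_coefE lead_coef_eq0.
  have ub_c i : c i != 0 -> (i <= N)%N.
    by apply: contraR; rewrite -ltnNge => /ltnW/cN->.
  case: (ex_maxnP ex_c ub_c) => d cd0 maxd; exists d => //.
  by apply: contraTeq isT => /maxd; rewrite ltnn.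
have cdT : c d *m T = 0 by apply/eqP; rewrite -oppr_eq0 -cST cd1 mul0mx.
pose V := \matrix_(i < N.+1) c i.
have cV i : (c i <= V)%MS.
  case: (ltnP i N.+1) => [ltiN|/ltnW/cN->]; last exact: sub0mx.
  by have := row_sub (Ordinal ltiN) V; rewrite rowK.
have VS : (V *m S <= V *m T)%MS.
  apply/row_subP => i; rewrite row_mul rowK; case: i => [[|i] lti] /=.
    by rewrite cS0 sub0mx.
  by rewrite cST eqmx_opp submxMr.
(* [<<V>>] is a square matrix with the same row space as [V]. *)
exists <<V>>%MS; rewrite genmxE.
have -> : \rank (<<V>> *m S + <<V>> *m T)%MS = \rank (V *m T).
  rewrite (adds_eqmx (eqmxMr _ (genmxE V)) (eqmxMr _ (genmxE V))).
  by rewrite (addsmx_idPr VS).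
rewrite -(mxrank_mul_ker V T) -[X in (X < _)%N]addn0 ltn_add2l lt0n mxrank_eq0.
apply: contraNneq cd0 => cap0; rewrite -submx0 -cap0 sub_capmx cV.
exact/sub_kermxP.
Qed.

(** The block of size [k.+1 x k] is lower triangular with its diagonal on that of
    the whole matrix.  The block of size [l x l.+1] starts in row [k.+1] and
    column [k], so its first superdiagonal lies on the diagonal of the whole
    matrix.  The sizes [m] and [n] are kept apart so that the rows and the
    columns of a square matrix can be split differently. *)
Lemma deflating_trig (F : fieldType) (k l m n p : nat) (S T : 'M[F]_(m, n))
    (V : 'M[F]_(p, m)) :
  m = (k.+1 + l)%N -> n = (k + l.+1)%N ->
  (k < \rank V)%N -> (\rank (V *m S + V *m T)%MS <= k)%N ->
  exists P Z, [/\ P \in unitmx, Z \in unitmx,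
    is_trig_mx (P *m S *m Z) & is_trig_mx (P *m T *m Z)].
Proof.
move=> Em En; subst m n => rV rX.
have [P0 [Z0 [uP0 uZ0 S0 T0]]] := deflating_block rV rX.
have [P1 [Z1 [uP1 uZ1 tS1 tT1]]] :=
  tall_pair_trig (ulsubmx (P0 *m S *m Z0)) (ulsubmx (P0 *m T *m Z0)).
have [P2 [Z2 [uP2 uZ2 hS2 hT2]]] :=
  wide_pair_hess (drsubmx (P0 *m S *m Z0)) (drsubmx (P0 *m T *m Z0)).
exists (block_mx P1 0 0 P2 *m P0), (Z0 *m block_mx Z1 0 0 Z2).
rewrite !unitmx_mul uP0 uZ0 !block_diag_unitmx //.
have trig_block (A : 'M[F]_(k.+1, k)) (B : 'M[F]_(l, k)) (C : 'M[F]_(l, l.+1)) :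
    is_trig_mx A -> lower_hessenberg C ->
    is_trig_mx (block_mx A 0 B C).
  move=> /is_trig_mxP tA hC; apply/is_trig_mxP => i j; rewrite !mxE.
  case: split_ordP => i' ->; rewrite mxE; case: split_ordP => j' -> //=.
  - exact: tA.
  - by rewrite mxE.
  - by rewrite ltnNge (leq_trans (ltnW (ltn_ord j'))) // addSnnS leq_addr.
  - by rewrite addSnnS ltn_add2l; apply: hC.
split=> //; rewrite !mulmxA -2!(mulmxA (block_mx _ _ _ _)) mul_block_diag //;
  exact: trig_block.
Qed.

Lemma singular_trig (F : fieldType) (n : nat) (S T : 'M[F]_n) :
  \det (map_mx polyC S + 'X *: map_mx polyC T) = 0 ->
  exists P Z, [/\ P \in unitmx, Z \in unitmx,
    is_trig_mx (P *m S *m Z) & is_trig_mx (P *m T *m Z)].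
Proof.
case/singular_pencil_rank_drop => V rX.
case Ek: (\rank V) rX => [//|k]; rewrite ltnS => rX.
have En : n = (k.+1 + (n - k.+1))%N by rewrite subnKC // -Ek rank_leq_col.
by apply: (deflating_trig En _ _ rX); rewrite ?Ek // addnS.
Qed.

(** * Orthonormalization by triangular matrices *)

Lemma row_dot_ge0 (R : realDomainType) (n : nat) (u : 'rV[R]_n) :
  0 <= (u *m u^T) 0 0.
Proof. by rewrite mxE sumr_ge0 // => i _; rewrite mxE -expr2 sqr_ge0. Qed.

Lemma row_dot_eq0 (R : realDomainType) (n : nat) (u : 'rV[R]_n) :
  (u *m u^T == 0) = (u == 0).
Proof.
apply/eqP/eqP => [/matrixP/(_ 0 0)|->]; last by rewrite mul0mx.
rewrite !mxE => /eqP; rewrite psumr_eq0 => [/allP u0|i _]; last first.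
  by rewrite mxE -expr2 sqr_ge0.
apply/rowP=> i; have := u0 i (mem_index_enum i).
by rewrite !mxE mulf_eq0 orbb => /eqP.
Qed.

(** Gram-Schmidt: the first row is normalized to [q] and its component is removed
    from the other rows; the induction hypothesis then takes combinations of
    these, which stay orthogonal to [q]. *)
Lemma orthonormalize_lower (R : rcfType) (m n : nat) (A : 'M[R]_(m, n)) :
  row_free A ->
  exists L : 'M[R]_m, is_trig_mx L /\ (L *m A) *m (L *m A)^T = 1%:M.
Proof.
elim: m A => [|m IHm] A freeA.
  by exists 0; rewrite mx0_is_trig; split=> //; apply/matrixP=> -[].
suff step (B : 'M[R]_(1 + m, n)) : row_free B -> exists L : 'M_(1 + m),
    is_trig_mx L /\ (L *m B) *m (L *m B)^T = 1%:M by exact: step.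
move: B => {freeA}{}A freeA.
set a := usubmx A; set A' := dsubmx A.
have eqA : A = col_mx a A' by rewrite vsubmxK.
have a0 : a != 0.
  apply: contraTneq freeA => a0; rewrite -kermx_eq0 eqA a0.
  apply/eqP => /matrixP ker0.
  have /sub_kermxP : row_mx (1%:M : 'M[R]_1) (0 : 'rV[R]_m) *m col_mx 0 A' = 0
      :> 'rV[R]_n.
    by rewrite mul_row_col mulmx0 mul0mx addr0.
  have -> : kermx (col_mx (0 : 'rV_n) A') = 0 by apply/matrixP.
  rewrite submx0 => /eqP/rowP/(_ (lshift m 0)); rewrite row_mxEl !mxE => /eqP.
  by rewrite oner_eq0.
pose s := (a *m a^T) 0 0; pose c := (Num.sqrt s)^-1.
have s0 : 0 < s.
  rewrite lt0r; apply/andP; split.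
    apply: contra a0 => /eqP s0; rewrite -row_dot_eq0.
    by apply/eqP; rewrite [LHS]mx11_scalar -/s s0 raddf0.
  exact: row_dot_ge0.
pose q := c *: a.
have qq : q *m q^T = 1%:M.
  rewrite linearZ /= -scalemxAl -scalemxAr scalerA [a *m _]mx11_scalar -/s.
  rewrite -scalemx1 scalerA -expr2 exprVn sqr_sqrtr ?ltW // mulVf ?scale1r //.
  exact: lt0r_neq0.
pose u := A' *m q^T; pose B := A' - u *m q.
have Bq : B *m q^T = 0 by rewrite mulmxBl -mulmxA qq mulmx1 subrr.
have freeB : row_free B.
  rewrite -kermx_eq0; apply/eqP/row_matrixP => i; rewrite row0.
  set y := row i _.
  have: y *m B = 0 by apply/sub_kermxP/row_sub.
  rewrite mulmxBr mulmxA => yB0.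
  (* A relation [y] between the rows of [B] lifts to one between those of [A]. *)
  have /sub_kermxP : row_mx (- (y *m u) *m c%:M) y *m A = 0.
    by rewrite eqA mul_row_col -mulmxA mul_scalar_mx -/q mulNmx addrC.
  move: freeA; rewrite -kermx_eq0 => /eqP->; rewrite submx0 => /eqP.
  by rewrite -[RHS]row_mx0 => /eq_row_mx[].
have [L [tL oL]] := IHm B freeB.
exists (block_mx c%:M 0 (- (L *m u *m c%:M)) L).
have -> : block_mx c%:M 0 (- (L *m u *m c%:M)) L *m A = col_mx q (L *m B).
  rewrite {1}eqA mul_block_col mul0mx addr0 mul_scalar_mx -/q mulNmx.
  by rewrite -[_ *m c%:M *m a]mulmxA mul_scalar_mx -/q /B mulmxBr addrC !mulmxA.
split; first by rewrite is_trig_block_mx // eqxx mx11_is_trig.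
rewrite tr_col_mx mul_col_row qq oL -mulmxA Bq mulmx0.
by rewrite trmx_mul mulmxA -[q *m _]trmxK trmx_mul trmxK Bq trmx0 mul0mx
   -scalar_mx_block.
Qed.

(** Multiplying the first row by [\det Q], which is 1 or -1, makes the determinant
    equal to 1. *)
Lemma diag_in_SO (R : realType) (n : nat) (Q : 'M[R]_n) :
  Q *m Q^T = 1%:M -> exists d : 'rV_n, in_SO (diag_mx d *m Q).
Proof.
case: n Q => [|n] Q oQ.
  by exists 0; split; [apply/matrixP => -[] | rewrite det_mx00].
have detQ2 : \det Q * \det Q = 1.
  by rewrite -[X in _ * X]det_tr -det_mulmx oQ det1.
pose d : 'rV[R]_n.+1 := \row_j if j == 0 then \det Q else 1.
have det_d : \det (diag_mx d) = \det Q.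
  rewrite det_diag (bigD1 0) //= mxE eqxx big1 ?mulr1 // => i /negPf i0.
  by rewrite mxE i0.
have dd : diag_mx d *m diag_mx d = 1%:M.
  rewrite mulmx_diag; apply/matrixP => i j; rewrite !mxE.
  by case: (i == 0); rewrite ?detQ2 ?mulr1.
exists d; split; last by rewrite det_mulmx det_d.
apply: mulmx1C; rewrite trmx_mul tr_diag_mx mulmxA -(mulmxA _ Q) oQ mulmx1.
exact: dd.
Qed.

Lemma in_SO_tr (R : realType) (n : nat) (Q : 'M[R]_n) : in_SO Q -> in_SO Q^T.
Proof. by case=> oQ dQ; split; [rewrite trmxK; apply: mulmx1C | rewrite det_tr]. Qed.

Lemma lower_in_SO (R : realType) (n : nat) (A : 'M[R]_n) :
  A \in unitmx -> exists L, is_trig_mx L /\ in_SO (L *m A).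
Proof.
rewrite -row_free_unit => /orthonormalize_lower[L [tL /diag_in_SO[d]]].
rewrite mulmxA => SO_dLA; exists (diag_mx d *m L); split=> //.
by rewrite mulmx_is_trig ?diag_mx_is_trig.
Qed.

(** Gram-Schmidt from the last row upwards, obtained by reversing the order of
    the rows, orthonormalizing, and reversing back. *)
Lemma upper_in_SO (R : realType) (n : nat) (A : 'M[R]_n) :
  A \in unitmx -> exists U, is_trig_mx U^T /\ in_SO (U *m A).
Proof.
move=> uA; pose J := rev_mx R n.
have JJ : J^T *m J = 1%:M by rewrite tr_perm_mx -perm_mxM mulVg perm_mx1.
have freeJA : row_free (J^T *m A).
  by rewrite row_free_unit unitmx_mul unitmx_tr unitmx_perm.
have [L [/is_trig_mxP tL oL]] := orthonormalize_lower freeJA.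
have [d SO_U] : exists d : 'rV_n, in_SO (diag_mx d *m (J *m (L *m (J^T *m A)))).
  apply: diag_in_SO; rewrite trmx_mul -mulmxA (mulmxA _ _ J^T) oL mul1mx.
  exact: mulmx1C.
exists (diag_mx d *m (J *m L *m J^T)); split; last by rewrite -!mulmxA.
rewrite trmx_mul tr_diag_mx mulmx_is_trig ?diag_mx_is_trig //.
apply/is_trig_mxP => i j lt_ij; rewrite mxE rev_mxE tL //=.
by rewrite ltn_sub2l ?(leq_ltn_trans _ (ltn_ord j)).
Qed.

Theorem lemma6p1 (R : realType) (n : nat) (S T : 'M[R]_n)
    (hST : singular_pencil S T) :
  exists Q Z : 'M[R]_n,
    [/\ in_SO Q, in_SO Z,
        upper_triangular (Q *m S *m Z)
      & upper_triangular (Q *m T *m Z)].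
Proof.
have hST' : \det (map_mx polyC S^T + 'X *: map_mx polyC T^T) = 0.
  by rewrite -[LHS]det_tr raddfD /= linearZ /= -!map_trmx !trmxK.
have [P [Z [uP uZ tS tT]]] := singular_trig hST'.
have [L [tL SO_LP]] := lower_in_SO uP.
have uZt : Z^T \in unitmx by rewrite unitmx_tr.
have [U [tU SO_UZ]] := upper_in_SO uZt.
exists (U *m Z^T), (L *m P)^T; split=> //; first exact: in_SO_tr.
(* After transposition, [L] and [U^T] are lower triangular factors around the
   triangularized pencil. *)
all: have regroup A :
  (U *m Z^T *m A *m (L *m P)^T)^T = L *m (P *m A^T *m Z) *m U^T
  by rewrite !trmx_mul !trmxK !mulmxA.
all: by rewrite /upper_triangular regroup mulmx_is_trig // mulmx_is_trig.
Qed.
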